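(* Let $u$ be the solution of $$u_t=u_{xx},\quad 0<x<a,\ 0<t<T,$$ $$u_x(0,t)=u^{-p}(0,t),\quad u_x(a,t)=(1-u(a,t))^{-q},\quad 0<t<T,$$ $$u(x,0)=u_0(x),\quad 0\le x\le a,$$ with quenching time $T$. If $u_0$ satisfies $u_{xx}(x,0)\ge 0$ for $0<x<a$, then there exists a positive constant $C_1$ such that $$u(a,t)\le 1-C_1(T-t)^{1/(2q+2)}$$ for $t$ sufficiently close to the quenching time $T$.
   Context: Standing assumptions: $a,p,q>0$ are constants. The initial function $u_0$ is a non-negative smooth function on $[0,a]$ satisfying the compatibility conditions $u_0'(0)=u_0^{-p}(0)$ and $u_0'(a)=(1-u_0(a))^{-q}$. The quenching time of the solution is the finite time $T=T(u_0)<\infty$ such that $\lim_{t\to T^-}\min\{u(x,t):0\le x\le a\}=0$ or $\lim_{t\to T^-}\max\{u(x,t):0\le x\le a\}=1$. *)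

(* Defs.v *)
From Stdlib Require Import Reals.
From Coquelicot Require Import Coquelicot.
Open Scope R_scope.

(* [l] is the derivative at [x] of [f] regarded as a function on [[0,a]]: the
   usual derivative for 0 < x < a, the one-sided one at the end points. *)
Definition is_derive_seg (a : R) (f : R -> R) (x l : R) : Prop :=
  filterlim (fun y => (f y - f x) / (y - x))
    (within (fun y => 0 <= y <= a /\ y <> x) (locally x)) (locally l).

Definition smooth_seg (a : R) (f : R -> R) : Prop :=
  exists D : nat -> R -> R,
    (forall x, 0 <= x <= a -> D 0%nat x = f x) /\
    (forall n x, 0 <= x <= a -> is_derive_seg a (D n) x (D (S n) x)).

(* [Rpower] is only meaningful on positive bases; the compatibility conditions
   therefore carry the positivity of u0(0) and 1 - u0(a) that they presuppose. *)
Definition admissible_initial_datum (a p q : R) (u0 : R -> R) : Prop :=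
  smooth_seg a u0 /\
  (forall x, 0 <= x <= a -> 0 <= u0 x) /\
  0 < u0 0 /\ u0 a < 1 /\
  is_derive_seg a u0 0 (Rpower (u0 0) (- p)) /\
  is_derive_seg a u0 a (Rpower (1 - u0 a) (- q)).

(* Classical solution on [0,a] x [0,T), with values in (0,1) at positive times,
   of class C^0 on [0,a] x [0,T), with u_x continuous on [0,a] x (0,T) and
   u_t, u_xx continuous on (0,a) x (0,T). *)
Definition is_solution (a p q T : R) (u0 : R -> R) (u : R -> R -> R) : Prop :=
  continuous_on (fun z : R * R => 0 <= fst z <= a /\ 0 <= snd z < T)
    (fun z => u (fst z) (snd z)) /\
  (forall x t, 0 <= x <= a -> 0 < t < T -> 0 < u x t < 1) /\
  (forall x, 0 <= x <= a -> u x 0 = u0 x) /\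
  exists ux uxx ut : R -> R -> R,
    (forall x t, 0 <= x <= a -> 0 < t < T ->
       is_derive_seg a (fun y => u y t) x (ux x t)) /\
    (forall x t, 0 < x < a -> 0 < t < T ->
       is_derive (fun y => ux y t) x (uxx x t)) /\
    (forall x t, 0 < x < a -> 0 < t < T ->
       is_derive (fun s => u x s) t (ut x t)) /\
    continuous_on (fun z : R * R => 0 <= fst z <= a /\ 0 < snd z < T)
      (fun z => ux (fst z) (snd z)) /\
    continuous_on (fun z : R * R => 0 < fst z < a /\ 0 < snd z < T)
      (fun z => uxx (fst z) (snd z)) /\
    continuous_on (fun z : R * R => 0 < fst z < a /\ 0 < snd z < T)
      (fun z => ut (fst z) (snd z)) /\
    (forall x t, 0 < x < a -> 0 < t < T -> ut x t = uxx x t) /\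
    (forall t, 0 < t < T -> ux 0 t = Rpower (u 0 t) (- p)) /\
    (forall t, 0 < t < T -> ux a t = Rpower (1 - u a t) (- q)).

Definition is_min_seg (a : R) (f : R -> R) (m : R) : Prop :=
  (exists x, 0 <= x <= a /\ f x = m) /\ (forall x, 0 <= x <= a -> m <= f x).

Definition is_max_seg (a : R) (f : R -> R) (m : R) : Prop :=
  (exists x, 0 <= x <= a /\ f x = m) /\ (forall x, 0 <= x <= a -> f x <= m).

Definition quenches_at (a T : R) (u : R -> R -> R) : Prop :=
  (exists m : R -> R,
     (forall t, 0 < t < T -> is_min_seg a (fun x => u x t) (m t)) /\
     filterlim m (at_left T) (locally 0)) \/
  (exists M : R -> R,
     (forall t, 0 < t < T -> is_max_seg a (fun x => u x t) (M t)) /\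
     filterlim M (at_left T) (locally 1)).

(* Main.v *)
Require Import Defs.
From Stdlib Require Import Reals.
From Stdlib Require Import Lra Classical ClassicalEpsilon.
From Coquelicot Require Import Coquelicot.
Open Scope R_scope.

(** Write [w t = 1 - u a t]. Comparing [u] with [u0], then with its own time
    translates, shows that [u] is nondecreasing in time; hence [u_xx = u_t >= 0]
    and each profile lies above its tangent at [x = a].
    Given [t1] close to [T], let [t < t1] be a time with [w t = 2 * w t1] (if
    there is none, [w t1] is bounded below and the estimate is trivial). After
    subtracting from [u] its tangent at time [t], one gets a nonnegative solution
    of the heat equation whose flux at [x = a] is at least
    [K = w(t1)^(-q) - (2 w(t1))^(-q)] from [t1] on. An explicit caloric polynomial
    then shows that this solution exceeds [c K sqrt(T - t1)] at [x = a] before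
    time [T]. There it is at most [2 w(t1)], since [u < 1], so
    [w(t1)^(q+1) >= c' sqrt(T - t1)]. *)

(** * Continuity on segments and attained minima on rectangles *)

Lemma locally_open_interval (b c x : R) : b < x < c -> locally x (fun y => b < y < c).
Proof.
  apply (open_and (fun y => b < y) (fun y => y < c)); [apply open_gt | apply open_lt].
Qed.

Lemma continuous_on_comp {T U V : UniformSpace} (D : U -> Prop) (E : T -> Prop)
  (f : U -> V) (g : T -> U) :
  (forall z, E z -> D (g z)) -> (forall z, continuous g z) ->
  continuous_on D f -> continuous_on E (fun z => f (g z)).
Proof.
  intros HED Hg Hf z Hz P HP.
  specialize (Hf (g z) (HED z Hz) P HP).
  specialize (Hg z _ Hf).
  unfold filtermap, within in *.
  revert Hg; apply filter_imp; intros y Hy Ey; apply Hy; auto.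
Qed.

Lemma continuous_on_comp_2 {T : UniformSpace} (D : T -> Prop) (f g : T -> R)
  (h : R -> R -> R) :
  continuous_on D f -> continuous_on D g ->
  (forall z : R * R, continuous (fun z => h (fst z) (snd z)) z) ->
  continuous_on D (fun x => h (f x) (g x)).
Proof.
  intros Hf Hg Hh x Hx.
  apply (filterlim_comp_2 (G := locally (f x)) (H := locally (g x))).
  - now apply Hf.
  - now apply Hg.
  - intros P HP. specialize (Hh (f x, g x) P HP).
    destruct Hh as [e He].
    exists (fun y => ball (f x) e y) (fun y => ball (g x) e y);
      try apply locally_ball.
    intros y z Hy Hz. apply (He (y, z)). now split.
Qed.

(** For [b <= c], the retraction of the line onto [[b, c]]. Composing with it extends a function
    continuous on a segment or rectangle to one continuous everywhere, the form that the compactness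
    and mean value theorems below ask for. *)
Definition clamp (b c x : R) : R := Rmax b (Rmin c x).

Lemma clamp_bounds (b c x : R) : b <= c -> b <= clamp b c x <= c.
Proof.
  intros H; unfold clamp; split.
  - apply Rmax_l.
  - apply Rmax_lub; [lra | apply Rmin_l].
Qed.

Lemma clamp_id (b c x : R) : b <= x <= c -> clamp b c x = x.
Proof.
  intros H; unfold clamp.
  rewrite Rmin_right, Rmax_right; lra.
Qed.

Lemma continuous_clamp (b c x : R) : continuous (clamp b c) x.
Proof.
  apply filterlim_locally; intros eps; exists eps; intros y Hy.
  change (Rabs (y - x) < eps) in Hy.
  change (Rabs (clamp b c y - clamp b c x) < eps).
  apply Rle_lt_trans with (2 := Hy).
  unfold clamp, Rmax, Rmin;
    repeat destruct Rle_dec; unfold Rabs; repeat destruct Rcase_abs; lra.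
Qed.

Lemma continuous_pair {T U V : UniformSpace} (f : T -> U) (g : T -> V) (x : T) :
  continuous f x -> continuous g x -> continuous (fun y => (f y, g y)) x.
Proof.
  intros Hf Hg; apply filterlim_locally; intros eps.
  assert (H1 := proj1 (filterlim_locally _ _) Hf eps).
  assert (H2 := proj1 (filterlim_locally _ _) Hg eps).
  generalize (filter_and _ _ H1 H2); apply filter_imp; intros y [Hy1 Hy2]; now split.
Qed.

Lemma continuous_clamp_2 (b c s t : R) (z : R * R) :
  continuous (fun z : R * R => (clamp b c (fst z), clamp s t (snd z))) z.
Proof.
  apply (continuous_pair (fun z : R * R => clamp b c (fst z)) (fun z : R * R => clamp s t (snd z))).
  - apply (continuous_comp (fun z : R * R => fst z)), continuous_clamp; apply continuous_fst.
  - apply (continuous_comp (fun z : R * R => snd z)), continuous_clamp; apply continuous_snd.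
Qed.

(** Around each [z] choose a radius at most [f z / 2] on which [f] stays above [f z / 2].
    Compactness bounds the radii in use below by a single [d], and this [d] is then also a lower
    bound for [f]. *)
Lemma positive_bounded_below_rectangle (b c s t : R) (f : R * R -> R) :
  b <= c -> s <= t -> (forall z, continuous f z) -> (forall z, 0 < f z) ->
  exists m, 0 < m /\ forall x y, b <= x <= c -> s <= y <= t -> m <= f (x, y).
Proof.
  intros Hbc Hst Hc Hp.
  assert (H : forall z, exists d : posreal, d <= f z / 2 /\
            forall y, ball z d y -> f z / 2 < f y).
  { intros z.
    assert (He : 0 < f z / 2) by (generalize (Hp z); lra).
    destruct (proj1 (filterlim_locally _ _) (Hc z) (mkposreal _ He)) as [d Hd].
    assert (Hm : 0 < Rmin d (f z / 2)) by (apply Rmin_case; [apply d | lra]).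
    exists (mkposreal _ Hm); split; [apply Rmin_r|].
    intros y Hy.
    assert (Hb : ball z d y) by (eapply ball_le; [|exact Hy]; apply Rmin_l).
    specialize (Hd y Hb).
    change (Rabs (f y - f z) < f z / 2) in Hd.
    apply Rabs_def2 in Hd; lra. }
  set (delta := fun x y => proj1_sig (constructive_indefinite_description _ (H (x, y)))).
  destruct (compactness_value_2d b c s t delta) as [d Hd].
  exists d; split; [apply d|]; intros x y Hx Hy.
  (* [compactness_value_2d] provides the covering point only under a double negation. *)
  apply NNPP; intros Hn; apply (Hd x y Hx Hy); intros (u & v & _ & _ & H1 & H2 & H3).
  apply Hn; unfold delta in *.
  destruct (constructive_indefinite_description _ (H (u, v))) as [e [He1 He2]]; simpl in *.
  apply Rle_trans with (1 := H3), Rle_trans with (1 := He1), Rlt_le, He2.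
  now split.
Qed.

(** If the infimum were not attained, the function minus its infimum would be positive, hence
    bounded away from 0, and the infimum could be raised. *)
Lemma continuous_on_rectangle_min (b c s t : R) (f : R * R -> R) :
  b <= c -> s <= t ->
  continuous_on (fun z : R * R => b <= fst z <= c /\ s <= snd z <= t) f ->
  exists x0 t0, b <= x0 <= c /\ s <= t0 <= t /\
    forall x y, b <= x <= c -> s <= y <= t -> f (x0, t0) <= f (x, y).
Proof.
  intros Hbc Hst Hf.
  set (g := fun z : R * R => f (clamp b c (fst z), clamp s t (snd z))).
  assert (Hg : forall z, continuous g z).
  { intros z. apply (continuous_continuous_on (fun _ => True)).
    - apply filter_forall; auto.
    - apply (continuous_on_comp (fun z : R * R => b <= fst z <= c /\ s <= snd z <= t)
        (fun _ : R * R => True) f (fun z => (clamp b c (fst z), clamp s t (snd z)))).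
      + intros w _; simpl; split; now apply clamp_bounds.
      + intros w; apply continuous_clamp_2.
      + exact Hf. }
  assert (Hgf : forall x y, b <= x <= c -> s <= y <= t -> g (x, y) = f (x, y)).
  { intros x y Hx Hy; unfold g; simpl; now rewrite !clamp_id. }
  (* A positive lower bound [m] of [exp g] makes [g >= ln m], so the infimum of [g] exists; it is
     obtained as [- M], with [M] the supremum of [- g]. *)
  destruct (positive_bounded_below_rectangle b c s t (fun z => exp (g z)))
    as [m [Hm Hlow]]; auto.
  { intros z. apply (continuous_comp g exp); [apply Hg | apply continuous_exp]. }
  { intros z; apply exp_pos. }
  destruct (completeness (fun r => exists x y, b <= x <= c /\ s <= y <= t /\ r = - g (x, y)))
    as [M [HM1 HM2]].
  { exists (- ln m); intros r (x & y & Hx & Hy & ->).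
    apply Ropp_le_contravar. specialize (Hlow x y Hx Hy).
    rewrite <- (ln_exp (g (x, y))). now apply ln_le. }
  { exists (- g (b, s)), b, s; repeat split; lra. }
  apply NNPP; intros Hn.
  assert (Hlt : forall x y, b <= x <= c -> s <= y <= t -> - M < g (x, y)).
  { intros x y Hx Hy.
    assert (H1 : - g (x, y) <= M) by (apply HM1; exists x, y; auto).
    destruct (Rle_lt_or_eq_dec _ _ H1) as [H2 | H2]; [lra|].
    exfalso; apply Hn; exists x, y; split; [auto | split; [auto|]].
    intros x' y' Hx' Hy'.
    assert (H3 : - g (x', y') <= M) by (apply HM1; exists x', y'; auto).
    rewrite <- !Hgf by auto; lra. }
  set (h := fun z : R * R => g (clamp b c (fst z), clamp s t (snd z)) + M).
  destruct (positive_bounded_below_rectangle b c s t h) as [e [He Hlow']]; auto.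
  { intros z. unfold h. apply (continuous_plus (fun z : R * R => g (clamp b c (fst z), clamp s t (snd z)))).
    - apply (continuous_comp (fun z : R * R => (clamp b c (fst z), clamp s t (snd z))) g).
      + apply continuous_clamp_2.
      + apply Hg.
    - apply continuous_const. }
  { intros z; unfold h.
    generalize (Hlt _ _ (clamp_bounds b c (fst z) Hbc) (clamp_bounds s t (snd z) Hst)); lra. }
  assert (HM3 : M <= M - e).
  { apply HM2; intros r (x & y & Hx & Hy & ->).
    specialize (Hlow' x y Hx Hy); unfold h in Hlow'; simpl in Hlow'.
    rewrite !clamp_id in Hlow' by auto; lra. }
  lra.
Qed.

(** * Derivative tests at a minimum and the parabolic comparison principle *)

Lemma right_quotient_limit_nonneg (f : R -> R) (x l : R) :
  filterlim (fun y => (f y - f x) / (y - x)) (at_right x) (locally l) ->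
  at_right x (fun y => f x <= f y) -> 0 <= l.
Proof.
  intros Hl Hf.
  apply (filterlim_le (F := at_right x) (fun _ => 0) (fun y => (f y - f x) / (y - x)) 0 l);
    [ | apply filterlim_const | exact Hl].
  assert (Hr : at_right x (fun y => x < y)) by (exists (mkposreal 1 Rlt_0_1); auto).
  generalize (filter_and _ _ Hf Hr); apply filter_imp; intros y [H1 H2].
  apply Rmult_le_pos; [lra | apply Rlt_le, Rinv_0_lt_compat; lra].
Qed.

Lemma left_quotient_limit_nonpos (f : R -> R) (x l : R) :
  filterlim (fun y => (f y - f x) / (y - x)) (at_left x) (locally l) ->
  at_left x (fun y => f x <= f y) -> l <= 0.
Proof.
  intros Hl Hf.
  apply (filterlim_le (F := at_left x) (fun y => (f y - f x) / (y - x)) (fun _ => 0) l 0);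
    [ | exact Hl | apply filterlim_const ].
  assert (Hr : at_left x (fun y => y < x)) by (exists (mkposreal 1 Rlt_0_1); auto).
  generalize (filter_and _ _ Hf Hr); apply filter_imp; intros y [H1 H2].
  replace ((f y - f x) / (y - x)) with (- ((f y - f x) / (x - y))) by (field; lra).
  assert (0 <= (f y - f x) / (x - y)); [|lra].
  apply Rmult_le_pos; [lra | apply Rlt_le, Rinv_0_lt_compat; lra].
Qed.

Lemma is_derive_quotient (f : R -> R) (x l : R) :
  is_derive f x l ->
  filterlim (fun y => (f y - f x) / (y - x)) (locally' x) (locally l).
Proof.
  intros H; apply is_derive_Reals in H.
  apply filterlim_locally; intros eps.
  destruct (H eps (cond_pos eps)) as [d Hd].
  exists d; intros y Hy Hne.
  change (Rabs ((f y - f x) / (y - x) - l) < eps).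
  change (Rabs (y - x) < d) in Hy.
  specialize (Hd (y - x)). rewrite Rplus_minus in Hd.
  apply Hd; [now apply Rminus_eq_contra | exact Hy].
Qed.

Lemma at_right_le_locally' (x : R) : filter_le (at_right x) (locally' x).
Proof.
  intros P; unfold at_right, at_left, locally', within; apply filter_imp.
  intros y Hy Hlt; apply Hy; lra.
Qed.

Lemma at_left_le_locally' (x : R) : filter_le (at_left x) (locally' x).
Proof.
  intros P; unfold at_right, at_left, locally', within; apply filter_imp.
  intros y Hy Hlt; apply Hy; lra.
Qed.

Lemma is_derive_left_min (f : R -> R) (x l : R) :
  is_derive f x l -> at_left x (fun y => f x <= f y) -> l <= 0.
Proof.
  intros H; apply left_quotient_limit_nonpos.
  eapply filterlim_filter_le_1; [apply at_left_le_locally' | now apply is_derive_quotient].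
Qed.

Lemma is_derive_right_min (f : R -> R) (x l : R) :
  is_derive f x l -> at_right x (fun y => f x <= f y) -> 0 <= l.
Proof.
  intros H; apply right_quotient_limit_nonneg.
  eapply filterlim_filter_le_1; [apply at_right_le_locally' | now apply is_derive_quotient].
Qed.

(** The first derivative vanishes at [x]. If [l < 0], it would be negative just to the right of [x],
    and the mean value theorem would push [f] below its minimum. *)
Lemma second_derivative_min (b c : R) (f f1 : R -> R) (x l : R) :
  b < x < c -> (forall y, b < y < c -> is_derive f y (f1 y)) ->
  is_derive f1 x l -> (forall y, b < y < c -> f x <= f y) -> 0 <= l.
Proof.
  intros Hx H1 H2 Hmin.
  assert (Hloc := locally_open_interval b c x Hx).
  assert (Hfx : f1 x = 0).
  { apply Rle_antisym.
    - eapply is_derive_left_min; [now apply H1|].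
      apply filter_le_within; revert Hloc; apply filter_imp; auto.
    - eapply is_derive_right_min; [now apply H1|].
      apply filter_le_within; revert Hloc; apply filter_imp; auto. }
  apply Rnot_lt_le; intros Hl.
  apply is_derive_Reals in H2.
  destruct (H2 (- l)) as [d Hd]; [lra|].
  set (h := Rmin (d / 2) ((c - x) / 2)).
  assert (Hh : 0 < h) by (unfold h; apply Rmin_case; [generalize (cond_pos d) |]; lra).
  assert (Hh1 : h < d) by (unfold h; generalize (Rmin_l (d / 2) ((c - x) / 2)) (cond_pos d); lra).
  assert (Hh2 : x + h < c) by (unfold h; generalize (Rmin_r (d / 2) ((c - x) / 2)); lra).
  destruct (MVT_cor2 f f1 x (x + h)) as [y [Hy1 Hy2]]; [lra | |].
  { intros y Hy; apply is_derive_Reals, H1; lra. }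
  specialize (Hd (y - x)); rewrite Rabs_pos_eq in Hd by lra.
  specialize (Hd ltac:(lra) ltac:(lra)).
  replace (x + (y - x)) with y in Hd by ring.
  rewrite Hfx, Rminus_0_r in Hd; apply Rabs_def2 in Hd.
  assert (Hneg : f1 y < 0).
  { replace (f1 y) with ((f1 y / (y - x)) * (y - x)) by (field; lra). nra. }
  specialize (Hmin (x + h)); assert (f x <= f (x + h)) by (apply Hmin; lra).
  nra.
Qed.

(* The barrier [exp (lam t + k (x - m)^2)], [m] the midpoint, absorbs the
   wrong-signed Robin conditions once [k (c - b) > L]. *)
Lemma robin_comparison (b c t0 t1 L : R) (D Dx Dxx Dt : R -> R -> R) :
  b < c -> t0 <= t1 -> 0 <= L ->
  continuous_on (fun z : R * R => b <= fst z <= c /\ t0 <= snd z <= t1)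
    (fun z => D (fst z) (snd z)) ->
  (forall x, b <= x <= c -> 0 <= D x t0) ->
  (forall x t, b < x < c -> t0 < t <= t1 -> is_derive (fun y => D y t) x (Dx x t)) ->
  (forall x t, b < x < c -> t0 < t <= t1 -> is_derive (fun y => Dx y t) x (Dxx x t)) ->
  (forall x t, b < x < c -> t0 < t <= t1 -> is_derive (fun s => D x s) t (Dt x t)) ->
  (forall x t, b < x < c -> t0 < t <= t1 -> Dxx x t <= Dt x t) ->
  (forall t, t0 < t <= t1 -> D b t < 0 ->
     exists l, filterlim (fun y => (D y t - D b t) / (y - b)) (at_right b) (locally l)
               /\ l <= - L * D b t) ->
  (forall t, t0 < t <= t1 -> D c t < 0 ->
     exists l, filterlim (fun y => (D y t - D c t) / (y - c)) (at_left c) (locally l)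
               /\ L * D c t <= l) ->
  forall x t, b <= x <= c -> t0 <= t <= t1 -> 0 <= D x t.
Proof.
  intros Hbc H01 HL Hcont Hinit HDx HDxx HDt Hineq Hleft Hright x1 s1 Hx1 Hs1.
  apply Rnot_lt_le; intros Hneg.
  set (m := (b + c) / 2).
  set (k := (L + 1) / (c - b)).
  assert (Hk : k * (c - b) = L + 1) by (unfold k; field; lra).
  assert (Hk0 : 0 < k) by (unfold k; apply Rdiv_lt_0_compat; lra).
  (* On [[b, c]] one has [P_xx / P = 2 k + (2 k (x - m))^2 <= 2 k + (L + 1)^2], so this [lam] makes
     [P_t > P_xx]. *)
  set (lam := 2 * k + (L + 1) ^ 2 + 1).
  set (P := fun x t => exp (lam * t + k * (x - m) ^ 2)).
  assert (HP : forall x t, 0 < P x t) by (intros; apply exp_pos).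
  destruct (continuous_on_rectangle_min b c t0 t1
     (fun z => D (fst z) (snd z) * / P (fst z) (snd z))) as (x0 & s0 & Hx0 & Hs0 & Hmin);
    [lra | lra | |].
  { apply (continuous_on_comp_2 _ (fun z => D (fst z) (snd z))
       (fun z : R * R => / P (fst z) (snd z)) Rmult).
    - exact Hcont.
    - apply continuous_on_forall; intros [x t] _; unfold P.
      apply (continuous_ext (fun z : R * R => exp (- (lam * snd z + k * (fst z - m) ^ 2)))).
      { intros z; apply exp_Ropp. }
      apply (continuous_comp (fun z : R * R => - (lam * snd z + k * (fst z - m) ^ 2)) exp).
      2: apply continuous_exp.
      apply (continuous_opp (fun z : R * R => lam * snd z + k * (fst z - m) ^ 2)).
      apply (continuous_plus (fun z : R * R => lam * snd z) (fun z : R * R => k * (fst z - m) ^ 2)).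
      + apply (continuous_mult (fun _ => lam) (fun z : R * R => snd z)).
        * apply continuous_const.
        * apply continuous_snd.
      + apply (continuous_comp (fun z : R * R => fst z) (fun y => k * (y - m) ^ 2)).
        * apply continuous_fst.
        * apply (ex_derive_continuous (fun y => k * (y - m) ^ 2)); auto_derive; auto.
    - intros [y z]. apply (continuous_mult (fun z : R * R => fst z) (fun z : R * R => snd z)).
      + apply continuous_fst.
      + apply continuous_snd. }
  simpl in Hmin.
  (* [- eps] is the minimum of [D / P], negative by the assumption to be refuted; hence
     [H = D + eps P] is nonnegative and vanishes at [(x0, s0)]. *)
  set (eps := - (D x0 s0 * / P x0 s0)).
  assert (Heps : 0 < eps).
  { unfold eps. specialize (Hmin x1 s1 Hx1 Hs1).
    assert (0 < / P x1 s1) by apply Rinv_0_lt_compat, HP. nra. }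
  set (H := fun x t => D x t + eps * P x t).
  assert (HD0 : D x0 s0 = - (eps * P x0 s0)).
  { unfold eps; field. generalize (HP x0 s0); lra. }
  assert (HH0 : H x0 s0 = 0) by (unfold H; rewrite HD0; ring).
  assert (HH : forall x t, b <= x <= c -> t0 <= t <= t1 -> H x0 s0 <= H x t).
  { intros x t Hx Ht. rewrite HH0. unfold H.
    specialize (Hmin x t Hx Ht).
    assert (HPi : 0 < P x t) by apply HP.
    assert (H1 : - eps <= D x t * / P x t) by (unfold eps; lra).
    apply (Rmult_le_compat_r (P x t)) in H1; [|lra].
    rewrite Rmult_assoc, Rinv_l, Rmult_1_r in H1 by lra. lra. }
  assert (Hpos : 0 < eps * P x0 s0) by (apply Rmult_lt_0_compat; auto).
  assert (Hs0' : t0 < s0).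
  { destruct (Rle_lt_or_eq_dec _ _ (proj1 Hs0)) as [|He]; [auto|].
    exfalso. specialize (Hinit x0 Hx0). rewrite He in Hinit. lra. }
  assert (HPx : forall x t, is_derive (fun y => P y t) x (2 * k * (x - m) * P x t)).
  { intros x t; unfold P; auto_derive; [auto|]; unfold Rminus; simpl; ring. }
  destruct (Rle_lt_or_eq_dec _ _ (proj1 Hx0)) as [Hb | Hb];
    [destruct (Rle_lt_or_eq_dec _ _ (proj2 Hx0)) as [Hc | Hc] |].
  (* Interior zero of [H]: [H_xx >= 0] and [H_t <= 0] contradict [D_xx <= D_t] combined with
     [P_xx < P_t]. *)
  - assert (Hxx : 0 <= Dxx x0 s0 + eps * ((2 * k + (2 * k * (x0 - m)) ^ 2) * P x0 s0)).
    { apply (second_derivative_min b c (fun y => H y s0)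
               (fun y => Dx y s0 + eps * (2 * k * (y - m) * P y s0)) x0).
      - lra.
      - intros y Hy; unfold H.
        apply (is_derive_plus (fun y => D y s0) (fun y => eps * P y s0)).
        + apply HDx; lra.
        + apply (is_derive_scal (fun y => P y s0)), HPx.
      - apply (is_derive_plus (fun y => Dx y s0) (fun y => eps * (2 * k * (y - m) * P y s0))).
        + apply HDxx; lra.
        + apply (is_derive_scal (fun y => 2 * k * (y - m) * P y s0)).
          unfold P; auto_derive; [auto|]; unfold Rminus; simpl; ring.
      - intros y Hy; apply HH; lra. }
    (* The zero may occur at the final time [t1], so only earlier times are compared. *)
    assert (Ht : Dt x0 s0 + eps * (lam * P x0 s0) <= 0).
    { apply (is_derive_left_min (fun s => H x0 s) s0).
      - apply (is_derive_plus (fun s => D x0 s) (fun s => eps * P x0 s)).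
        + apply HDt; lra.
        + apply (is_derive_scal (fun s => P x0 s)).
          unfold P; auto_derive; [auto|]; unfold Rminus; simpl; ring.
      - assert (Hd : 0 < s0 - t0) by lra.
        exists (mkposreal _ Hd); intros s Hs Hlt.
        change (Rabs (s - s0) < s0 - t0) in Hs. apply Rabs_def2 in Hs.
        apply HH; lra. }
    assert (Hi : Dxx x0 s0 <= Dt x0 s0) by (apply Hineq; lra).
    assert (Hsq : (2 * k * (x0 - m)) ^ 2 <= (L + 1) ^ 2).
    { rewrite <- Hk. apply pow_maj_Rabs. unfold m. apply Rabs_le; split; nra. }
    assert (Hlam : 2 * k + (2 * k * (x0 - m)) ^ 2 < lam) by (unfold lam; lra).
    assert (eps * P x0 s0 * (2 * k + (2 * k * (x0 - m)) ^ 2) < eps * P x0 s0 * lam)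
      by (apply Rmult_lt_compat_l; auto).
    lra.
  (* Zero at [x = c]: the slope of [H] is at most 0 there, while [l >= - L eps P] and the barrier
     adds [(L + 1) eps P], leaving at least [eps P > 0]. The end [x = b] is symmetric. *)
  - subst x0. destruct (Hright s0) as [l [Hl1 Hl2]]; [lra | lra |].
    assert (Hle : l + eps * (2 * k * (c - m) * P c s0) <= 0).
    { apply (left_quotient_limit_nonpos (fun y => H y s0) c).
      - apply (filterlim_ext_loc (fun y => (D y s0 - D c s0) / (y - c)
             + eps * ((P y s0 - P c s0) / (y - c)))).
        { exists (mkposreal 1 Rlt_0_1); intros y _ Hy; unfold H; field; lra. }
        apply (filterlim_comp_2 (G := locally l) (H := locally (eps * (2 * k * (c - m) * P c s0)))).
        + exact Hl1.
        + apply (filterlim_comp _ _ _ _ (fun y => eps * y) _ (locally (2 * k * (c - m) * P c s0))).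
          * eapply filterlim_filter_le_1; [apply at_left_le_locally'|].
            apply (is_derive_quotient (fun y => P y s0)), HPx.
          * apply (filterlim_scal_r (K := R_AbsRing) (V := R_NormedModule) eps).
        + apply (filterlim_plus (K := R_AbsRing) (V := R_NormedModule)).
      - assert (Hd : 0 < c - b) by lra.
        exists (mkposreal _ Hd); intros y Hy Hlt.
        change (Rabs (y - c) < c - b) in Hy. apply Rabs_def2 in Hy.
        apply HH; lra. }
    replace (2 * k * (c - m)) with (L + 1) in Hle by (rewrite <- Hk; unfold m; field).
    nra.
  - subst x0. destruct (Hleft s0) as [l [Hl1 Hl2]]; [lra | lra |].
    assert (Hle : 0 <= l + eps * (2 * k * (b - m) * P b s0)).
    { apply (right_quotient_limit_nonneg (fun y => H y s0) b).
      - apply (filterlim_ext_loc (fun y => (D y s0 - D b s0) / (y - b)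
             + eps * ((P y s0 - P b s0) / (y - b)))).
        { exists (mkposreal 1 Rlt_0_1); intros y _ Hy; unfold H; field; lra. }
        apply (filterlim_comp_2 (G := locally l) (H := locally (eps * (2 * k * (b - m) * P b s0)))).
        + exact Hl1.
        + apply (filterlim_comp _ _ _ _ (fun y => eps * y) _ (locally (2 * k * (b - m) * P b s0))).
          * eapply filterlim_filter_le_1; [apply at_right_le_locally'|].
            apply (is_derive_quotient (fun y => P y s0)), HPx.
          * apply (filterlim_scal_r (K := R_AbsRing) (V := R_NormedModule) eps).
        + apply (filterlim_plus (K := R_AbsRing) (V := R_NormedModule)).
      - assert (Hd : 0 < c - b) by lra.
        exists (mkposreal _ Hd); intros y Hy Hlt.
        change (Rabs (y - b) < c - b) in Hy. apply Rabs_def2 in Hy.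
        apply HH; lra. }
    replace (2 * k * (b - m)) with (- (L + 1)) in Hle by (rewrite <- Hk; unfold m; field).
    nra.
Qed.

(** * Mean values, Lipschitz bounds for negative powers, one-sided derivatives *)

Lemma continuous_on_clamp (b c : R) (f : R -> R) :
  b <= c -> continuous_on (fun y => b <= y <= c) f ->
  forall x, continuous (fun y => f (clamp b c y)) x.
Proof.
  intros Hbc Hf x.
  apply (continuous_continuous_on (fun _ => True)); [apply filter_forall; auto|].
  apply (continuous_on_comp (fun y => b <= y <= c) (fun _ : R => True) f (clamp b c)).
  - intros y _; now apply clamp_bounds.
  - intros y; apply continuous_clamp.
  - exact Hf.
Qed.

Lemma mean_value_seg (b c : R) (f df : R -> R) :
  b < c -> continuous_on (fun y => b <= y <= c) f ->
  (forall y, b < y < c -> is_derive f y (df y)) ->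
  exists y, b <= y <= c /\ f c - f b = df y * (c - b).
Proof.
  intros Hbc Hf Hd.
  destruct (MVT_gen (fun y => f (clamp b c y)) b c df) as [y [Hy1 Hy2]].
  - rewrite Rmin_left, Rmax_right by lra; intros y Hy.
    apply (is_derive_ext_loc f); [|now apply Hd].
    generalize (locally_open_interval b c y Hy); apply filter_imp; intros z Hz; rewrite clamp_id; [easy | lra].
  - intros y _; apply continuity_pt_filterlim, continuous_on_clamp; [lra | exact Hf].
  - rewrite Rmin_left, Rmax_right in Hy1 by lra.
    exists y; split; [exact Hy1|]. rewrite !clamp_id in Hy2 by lra; exact Hy2.
Qed.

(** On [[m, oo)] the derivative of [x^(-r)] is at most [r m^(-r-1)] in absolute value, which is the
    constant taken. *)
Lemma Rpower_opp_lipschitz (m r : R) : 0 < m -> 0 < r ->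
  exists L, 0 <= L /\ forall x y, m <= x -> x <= y ->
    Rpower x (- r) - Rpower y (- r) <= L * (y - x).
Proof.
  intros Hm Hr.
  exists (r * Rpower m (- r - 1)).
  assert (Hp : 0 < Rpower m (- r - 1)) by apply exp_pos.
  split; [nra|]. intros x y Hx Hxy.
  destruct (Rle_lt_or_eq_dec _ _ Hxy) as [Hlt | ->]; [|lra].
  destruct (MVT_cor2 (fun z => Rpower z (- r)) (fun z => - r * Rpower z (- r - 1)) x y)
    as [z [Hz1 Hz2]]; [exact Hlt | |].
  - intros z Hz; apply derivable_pt_lim_power; lra.
  - assert (H : Rpower z (- r - 1) <= Rpower m (- r - 1)).
    { replace (- r - 1) with (- (r + 1)) by ring. rewrite !Rpower_Ropp.
      apply Rinv_le_contravar; [apply exp_pos|].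
      apply Rle_Rpower_l; lra. }
    assert (r * Rpower z (- r - 1) <= r * Rpower m (- r - 1)) by (apply Rmult_le_compat_l; lra).
    nra.
Qed.

Lemma is_derive_seg_at_right (a : R) (f : R -> R) (l : R) : 0 < a ->
  is_derive_seg a f 0 l ->
  filterlim (fun y => (f y - f 0) / (y - 0)) (at_right 0) (locally l).
Proof.
  intros Ha; apply filterlim_filter_le_1; intros P [d Hd].
  assert (Hm : 0 < Rmin d a) by (apply Rmin_case; [apply d | exact Ha]).
  exists (mkposreal _ Hm); intros y Hy Hlt.
  assert (Hy' : Rabs (y - 0) < Rmin d a) by exact Hy.
  apply Hd.
  - eapply ball_le; [|exact Hy]; apply Rmin_l.
  - apply Rabs_def2 in Hy'. generalize (Rmin_r d a); split; lra.
Qed.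

Lemma is_derive_seg_at_left (a : R) (f : R -> R) (l : R) : 0 < a ->
  is_derive_seg a f a l ->
  filterlim (fun y => (f y - f a) / (y - a)) (at_left a) (locally l).
Proof.
  intros Ha; apply filterlim_filter_le_1; intros P [d Hd].
  assert (Hm : 0 < Rmin d a) by (apply Rmin_case; [apply d | exact Ha]).
  exists (mkposreal _ Hm); intros y Hy Hlt.
  assert (Hy' : Rabs (y - a) < Rmin d a) by exact Hy.
  apply Hd.
  - eapply ball_le; [|exact Hy]; apply Rmin_l.
  - apply Rabs_def2 in Hy'. generalize (Rmin_r d a); split; lra.
Qed.

Lemma is_derive_seg_interior (a : R) (f : R -> R) (x l : R) : 0 < x < a ->
  is_derive_seg a f x l -> is_derive f x l.
Proof.
  intros Hx H; apply is_derive_Reals; intros eps Heps.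
  destruct (proj1 (filterlim_locally _ _) H (mkposreal _ Heps)) as [d Hd].
  assert (Hm : 0 < Rmin d (Rmin x (a - x))) by (repeat apply Rmin_case; [apply d | lra | lra]).
  exists (mkposreal _ Hm); intros h Hne Hh; simpl in Hh.
  assert (H1 := Rmin_l d (Rmin x (a - x))).
  assert (H2 := Rmin_r d (Rmin x (a - x))).
  assert (H3 := Rmin_l x (a - x)). assert (H4 := Rmin_r x (a - x)).
  assert (H5 := Rabs_def2 _ _ Hh).
  specialize (Hd (x + h)).
  assert (Hb : ball x d (x + h)).
  { change (Rabs (x + h - x) < d). replace (x + h - x) with h by ring. lra. }
  specialize (Hd Hb ltac:(split; lra)).
  change (Rabs ((f (x + h) - f x) / (x + h - x) - l) < eps) in Hd.
  now replace (x + h - x) with h in Hd by ring.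
Qed.

Lemma is_derive_is_derive_seg (a : R) (f : R -> R) (x l : R) :
  is_derive f x l -> is_derive_seg a f x l.
Proof.
  intros H; apply is_derive_quotient in H; revert H.
  apply filterlim_filter_le_1; intros P.
  unfold locally', within; apply filter_imp; tauto.
Qed.

Lemma is_derive_seg_ext (a : R) (f g : R -> R) (x l : R) : 0 <= x <= a ->
  (forall y, 0 <= y <= a -> f y = g y) -> is_derive_seg a f x l -> is_derive_seg a g x l.
Proof.
  intros Hx Hfg; apply filterlim_within_ext.
  intros y [Hy _]; now rewrite !Hfg.
Qed.

Lemma is_derive_seg_minus (a : R) (f g : R -> R) (x l k : R) :
  is_derive_seg a f x l -> is_derive_seg a g x k ->
  is_derive_seg a (fun y => f y - g y) x (l - k).
Proof.
  intros Hf Hg.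
  apply (filterlim_within_ext (fun y => 0 <= y <= a /\ y <> x)
    (fun y => (f y - f x) / (y - x) + - ((g y - g x) / (y - x)))).
  - intros y [_ Hy]; field; now apply Rminus_eq_contra.
  - apply (filterlim_comp_2 (G := locally l) (H := locally (- k)) _ _ Rplus); [exact Hf | |].
    + apply (filterlim_comp _ _ _ (fun y => (g y - g x) / (y - x)) Ropp _ (locally k));
        [exact Hg | apply (filterlim_opp (K := R_AbsRing) (V := R_NormedModule))].
    + apply (filterlim_plus (K := R_AbsRing) (V := R_NormedModule)).
Qed.

(** * Comparison for the nonlinear fluxes and monotonicity in time *)

Lemma continuous_on_minus_2 (E : R * R -> Prop) (U V : R -> R -> R) :
  continuous_on E (fun z => U (fst z) (snd z)) ->
  continuous_on E (fun z => V (fst z) (snd z)) ->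
  continuous_on E (fun z => U (fst z) (snd z) - V (fst z) (snd z)).
Proof.
  intros HU HV; apply (continuous_on_comp_2 E (fun z => U (fst z) (snd z))
    (fun z => V (fst z) (snd z)) Rminus HU HV).
  intros z; apply (continuous_minus (fun z : R * R => fst z) (fun z : R * R => snd z));
    [apply continuous_fst | apply continuous_snd].
Qed.

(* The fluxes [v^(-p)] and [(1-v)^(-q)] enter with the destabilizing sign; they
   are Lipschitz where [U 0] and [1 - V a] stay away from 0, which is all that
   is used at points with [U < V]. *)
Lemma flux_comparison (a p q tau : R) (U Ux Uxx Ut V Vx Vxx Vt : R -> R -> R) :
  0 < a -> 0 < p -> 0 < q -> 0 <= tau ->
  continuous_on (fun z : R * R => 0 <= fst z <= a /\ 0 <= snd z <= tau)
    (fun z => U (fst z) (snd z)) ->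
  continuous_on (fun z : R * R => 0 <= fst z <= a /\ 0 <= snd z <= tau)
    (fun z => V (fst z) (snd z)) ->
  (forall t, 0 <= t <= tau -> 0 < U 0 t) ->
  (forall t, 0 <= t <= tau -> V a t < 1) ->
  (forall x, 0 <= x <= a -> V x 0 <= U x 0) ->
  (forall x t, 0 < x < a -> 0 < t <= tau ->
     is_derive (fun y => U y t) x (Ux x t) /\ is_derive (fun y => Ux y t) x (Uxx x t) /\
     is_derive (fun s => U x s) t (Ut x t) /\ Uxx x t <= Ut x t) ->
  (forall x t, 0 < x < a -> 0 < t <= tau ->
     is_derive (fun y => V y t) x (Vx x t) /\ is_derive (fun y => Vx y t) x (Vxx x t) /\
     is_derive (fun s => V x s) t (Vt x t) /\ Vt x t <= Vxx x t) ->
  (forall t, 0 < t <= tau ->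
     is_derive_seg a (fun y => U y t) 0 (Rpower (U 0 t) (- p)) /\
     is_derive_seg a (fun y => U y t) a (Rpower (1 - U a t) (- q))) ->
  (forall t, 0 < t <= tau ->
     is_derive_seg a (fun y => V y t) 0 (Rpower (V 0 t) (- p)) /\
     is_derive_seg a (fun y => V y t) a (Rpower (1 - V a t) (- q))) ->
  forall x t, 0 <= x <= a -> 0 <= t <= tau -> V x t <= U x t.
Proof.
  intros Ha Hp Hq Htau HcU HcV HU0 HVa Hinit HU HV HbU HbV x1 s1 Hx1 Hs1.
  (* Degenerate rectangles: the minima over time of [U] at [x = 0] and of [1 - V] at [x = a] serve
     as the positive thresholds for the Lipschitz bounds. *)
  destruct (continuous_on_rectangle_min 0 0 0 tau (fun z => U (fst z) (snd z)))
    as (x0 & t0 & Hx0 & Ht0 & Hmin0); [lra | lra | |].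
  { revert HcU; apply continuous_on_subset; intros z Hz; lra. }
  destruct (continuous_on_rectangle_min a a 0 tau (fun z => 1 - V (fst z) (snd z)))
    as (xa & ta & Hxa & Hta & Hmina); [lra | lra | |].
  { apply (continuous_on_minus_2 _ (fun _ _ => 1) V).
    - apply continuous_on_forall; intros z _; apply continuous_const.
    - revert HcV; apply continuous_on_subset; intros z Hz; lra. }
  simpl in Hmin0, Hmina.
  replace x0 with 0 in Hmin0 by lra. replace xa with a in Hmina by lra.
  destruct (Rpower_opp_lipschitz (U 0 t0) p) as [L0 [HL0 HLip0]]; auto.
  destruct (Rpower_opp_lipschitz (1 - V a ta) q) as [La [HLa HLipa]]; auto.
  { generalize (HVa ta Hta); lra. }
  assert (HL : L0 <= L0 + La /\ La <= L0 + La) by lra.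
  apply Rminus_le_0.
  apply (robin_comparison 0 a 0 tau (L0 + La) (fun x t => U x t - V x t)
    (fun x t => Ux x t - Vx x t) (fun x t => Uxx x t - Vxx x t)
    (fun x t => Ut x t - Vt x t)); auto.
  - lra.
  - now apply continuous_on_minus_2.
  - intros x Hx; generalize (Hinit x Hx); lra.
  - intros x t Hx Ht; apply (is_derive_minus (fun y => U y t) (fun y => V y t));
      [apply HU | apply HV]; auto.
  - intros x t Hx Ht; apply (is_derive_minus (fun y => Ux y t) (fun y => Vx y t));
      [apply HU | apply HV]; auto.
  - intros x t Hx Ht; apply (is_derive_minus (fun s => U x s) (fun s => V x s));
      [apply HU | apply HV]; auto.
  - intros x t Hx Ht; destruct (HU x t Hx Ht) as (_ & _ & _ & H1);
      destruct (HV x t Hx Ht) as (_ & _ & _ & H2); lra.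
  - intros t Ht Hneg; exists (Rpower (U 0 t) (- p) - Rpower (V 0 t) (- p)); split.
    + apply (is_derive_seg_at_right a (fun y => U y t - V y t)); auto.
      apply is_derive_seg_minus; [apply HbU | apply HbV]; auto.
    (* Since [U < V] here, both arguments of the power lie above the threshold [U 0 t0]. *)
    + assert (H : U 0 t0 <= U 0 t) by (apply Hmin0; lra).
      specialize (HLip0 (U 0 t) (V 0 t) H ltac:(lra)). nra.
  - intros t Ht Hneg; exists (Rpower (1 - U a t) (- q) - Rpower (1 - V a t) (- q)); split.
    + apply (is_derive_seg_at_left a (fun y => U y t - V y t)); auto.
      apply is_derive_seg_minus; [apply HbU | apply HbV]; auto.
    + assert (H : 1 - V a ta <= 1 - V a t) by (apply Hmina; lra).
      specialize (HLipa (1 - V a t) (1 - U a t) H ltac:(lra)). nra.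
Qed.

(** The initial profile, frozen in time, is a subsolution: convexity gives [V_t = 0 <= V_xx], and
    the compatibility conditions are exactly its flux conditions. *)
Lemma solution_ge_initial (a p q T : R) (u0 : R -> R) (u : R -> R -> R) :
  0 < a -> 0 < p -> 0 < q ->
  admissible_initial_datum a p q u0 -> is_solution a p q T u0 u ->
  (forall x, 0 < x < a -> 0 <= Derive_n (fun y => u y 0) 2 x) ->
  forall x t, 0 <= x <= a -> 0 <= t < T -> u x 0 <= u x t.
Proof.
  intros Ha Hp Hq (Hsm & _ & Hu00 & Hu0a & Hd0 & Hda)
    (Hc & Hrange & Hinit & ux & uxx & ut & Hux & Huxx & Hut & _ & _ & _ & Heq & Hb0 & Hba)
    Hconv x t Hx Ht.
  destruct Hsm as [D [HD0 HD]].
  assert (Hseg : forall y, 0 <= y <= a -> is_derive_seg a (fun z => u z 0) y (D 1%nat y)).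
  { intros y Hy; apply (is_derive_seg_ext a (D 0%nat)); [exact Hy | | now apply HD].
    intros z Hz; rewrite HD0, Hinit; auto. }
  assert (H1 : forall y, 0 < y < a -> is_derive (fun z => u z 0) y (D 1%nat y)).
  { intros y Hy; apply (is_derive_seg_interior a); [exact Hy | apply Hseg; lra]. }
  assert (H2 : forall y, 0 < y < a -> is_derive (D 1%nat) y (D 2%nat y)).
  { intros y Hy; apply (is_derive_seg_interior a); [exact Hy | apply HD; lra]. }
  (* The convexity hypothesis is about the total operator [Derive_n]; in the open interval this
     agrees with the derivative supplied by smoothness of [u0]. *)
  assert (HD2 : forall y, 0 < y < a -> 0 <= D 2%nat y).
  { intros y Hy; replace (D 2%nat y) with (Derive_n (fun y => u y 0) 2 y); [auto|].
    apply is_derive_unique; simpl.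
    apply (is_derive_ext_loc (D 1%nat)); [|now apply H2].
    generalize (locally_open_interval 0 a y Hy); apply filter_imp; intros z Hz.
    symmetry; apply is_derive_unique; now apply H1. }
  assert (Hpos : forall s, 0 <= s <= t -> 0 < u 0 s).
  { intros s Hs; destruct (Rle_lt_or_eq_dec _ _ (proj1 Hs)) as [Hlt | <-].
    - apply Hrange; lra.
    - rewrite Hinit; lra. }
  apply (flux_comparison a p q t u ux uxx ut (fun y _ => u y 0) (fun y _ => D 1%nat y)
    (fun y _ => D 2%nat y) (fun _ _ => 0)); auto; try lra.
  - revert Hc; apply continuous_on_subset; intros z Hz; lra.
  - apply (continuous_on_comp (fun z : R * R => 0 <= fst z <= a /\ 0 <= snd z < T)
      _ (fun z => u (fst z) (snd z)) (fun z : R * R => (fst z, 0))).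
    + intros z Hz; simpl; lra.
    + intros z; apply (continuous_pair (fun z : R * R => fst z) (fun _ => 0));
        [apply continuous_fst | apply continuous_const].
    + exact Hc.
  - intros s Hs; rewrite Hinit; lra.
  - intros y Hy; lra.
  - intros y s Hy Hs; refine (conj _ (conj _ (conj _ _))).
    + apply (is_derive_seg_interior a); [exact Hy | apply Hux; lra].
    + apply Huxx; lra.
    + apply Hut; lra.
    + rewrite Heq; lra.
  - intros y s Hy Hs; refine (conj _ (conj _ (conj _ _))); auto.
    apply (is_derive_const (K := R_AbsRing) (V := R_NormedModule)).
  - intros s Hs; rewrite <- Hb0, <- Hba by lra; split; apply Hux; lra.
  - intros s Hs; rewrite !Hinit by lra.
    split; (apply (is_derive_seg_ext a u0);
      [lra | intros y Hy; symmetry; now apply Hinit | assumption]).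
Qed.

(** The translate by [h = t - s] satisfies the same equation and flux conditions and starts from
    [u(., h) >= u(., 0)], so it stays above [u]. *)
Lemma solution_nondecreasing (a p q T : R) (u0 : R -> R) (u : R -> R -> R) :
  0 < a -> 0 < p -> 0 < q ->
  admissible_initial_datum a p q u0 -> is_solution a p q T u0 u ->
  (forall x, 0 < x < a -> 0 <= Derive_n (fun y => u y 0) 2 x) ->
  forall x s t, 0 <= x <= a -> 0 <= s <= t -> t < T -> u x s <= u x t.
Proof.
  intros Ha Hp Hq Hadm Hsol Hconv x s t Hx Hs Ht.
  assert (Hge := solution_ge_initial a p q T u0 u Ha Hp Hq Hadm Hsol Hconv).
  destruct Hadm as (_ & _ & Hu00 & Hu0a & _ & _).
  destruct Hsol as
    (Hc & Hrange & Hinit & ux & uxx & ut & Hux & Huxx & Hut & _ & _ & _ & Heq & Hb0 & Hba).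
  set (h := t - s).
  assert (Hh0 : 0 <= h) by (unfold h; lra).
  replace t with (s + h) by (unfold h; ring).
  destruct (Rle_lt_or_eq_dec _ _ Hh0) as [Hh | <-]; [|rewrite Rplus_0_r; lra].
  apply (flux_comparison a p q s (fun y r => u y (r + h)) (fun y r => ux y (r + h))
    (fun y r => uxx y (r + h)) (fun y r => ut y (r + h)) u ux uxx ut); auto; try lra.
  - apply (continuous_on_comp (fun z : R * R => 0 <= fst z <= a /\ 0 <= snd z < T)
      _ (fun z => u (fst z) (snd z)) (fun z : R * R => (fst z, snd z + h))).
    + intros z Hz; simpl; unfold h in *; lra.
    + intros z; apply (continuous_pair (fun z : R * R => fst z) (fun z : R * R => snd z + h)).
      * apply continuous_fst.
      * apply (continuous_plus (fun z : R * R => snd z) (fun _ => h));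
          [apply continuous_snd | apply continuous_const].
    + exact Hc.
  - revert Hc; apply continuous_on_subset; intros z Hz; lra.
  - intros r Hr; apply Hrange; [lra | unfold h in *; lra].
  - intros r Hr; destruct (Rle_lt_or_eq_dec _ _ (proj1 Hr)) as [Hlt | <-].
    + apply Hrange; lra.
    + rewrite Hinit; lra.
  - intros y Hy; apply Hge; [exact Hy | unfold h in *; lra].
  - intros y r Hy Hr; assert (Hr' : 0 < r + h < T) by (unfold h in *; lra); refine (conj _ (conj _ (conj _ _))).
    + apply (is_derive_seg_interior a (fun y => u y (r + h))); [exact Hy | apply Hux; lra].
    + now apply Huxx.
    + rewrite <- (Rmult_1_l (ut y (r + h))).
      apply (is_derive_comp (fun r => u y r) (fun r => r + h)); [now apply Hut|].
      auto_derive; [auto | ring].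
    + rewrite Heq; lra.
  - intros y r Hy Hr; refine (conj _ (conj _ (conj _ _))).
    + apply (is_derive_seg_interior a (fun y => u y r)); [exact Hy | apply Hux; lra].
    + apply Huxx; lra.
    + apply Hut; lra.
    + rewrite Heq; lra.
  - intros r Hr; rewrite <- Hb0, <- Hba by (unfold h in *; lra);
      split; apply Hux; unfold h in *; lra.
  - intros r Hr; rewrite <- Hb0, <- Hba by lra; split; apply Hux; lra.
Qed.

(** * Convexity in space and growth of the boundary value *)

Lemma continuous_on_slice (E : R * R -> Prop) (G : R -> Prop) (f : R -> R -> R) (t : R) :
  (forall y, G y -> E (y, t)) -> continuous_on E (fun z => f (fst z) (snd z)) ->
  continuous_on G (fun y => f y t).
Proof.
  intros HG Hf; apply (continuous_on_comp E G (fun z => f (fst z) (snd z)) (fun y => (y, t)));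
    [exact HG | | exact Hf].
  intros y; apply (continuous_pair (fun y : R => y) (fun _ => t));
    [apply continuous_id | apply continuous_const].
Qed.

(* Monotonicity in time gives [u_xx = u_t >= 0], so each profile lies above its
   tangent at [x = a]. *)
Lemma solution_above_tangent (a p q T : R) (u0 : R -> R) (u : R -> R -> R) :
  is_solution a p q T u0 u ->
  (forall x s t, 0 <= x <= a -> 0 <= s <= t -> t < T -> u x s <= u x t) ->
  forall x t, 0 <= x <= a -> 0 < t < T ->
    u a t + Rpower (1 - u a t) (- q) * (x - a) <= u x t.
Proof.
  intros (Hc & _ & _ & ux & uxx & ut & Hux & Huxx & Hut & Hcux & _ & _ & Heq & _ & Hba)
    Hmono x t Hx Ht.
  assert (Hxx : forall y, 0 < y < a -> 0 <= uxx y t).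
  { intros y Hy; rewrite <- Heq by auto.
    apply (is_derive_right_min (fun s => u y s) t); [now apply Hut|].
    assert (Hd : 0 < T - t) by lra.
    exists (mkposreal _ Hd); intros s Hs Hlt.
    change (Rabs (s - t) < T - t) in Hs; apply Rabs_def2 in Hs; apply Hmono; lra. }
  assert (Hle : forall y, 0 <= y <= a -> ux y t <= ux a t).
  { intros y Hy; destruct (Rle_lt_or_eq_dec _ _ (proj2 Hy)) as [Hlt | ->]; [|lra].
    (* The intermediate point may be an end point of [[0, a]], where [uxx] has no known sign; the
       truncation [Rmax 0] changes nothing inside and keeps the slope nonnegative there. *)
    destruct (mean_value_seg y a (fun z => ux z t) (fun z => Rmax 0 (uxx z t)))
      as [z [Hz1 Hz2]]; [exact Hlt | | |].
    - eapply continuous_on_slice; [|exact Hcux]; simpl; intros z Hz; lra.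
    - intros z Hz; rewrite Rmax_right by (apply Hxx; lra); apply Huxx; lra.
    - generalize (Rmax_l 0 (uxx z t)); nra. }
  rewrite <- Hba by exact Ht.
  destruct (Rle_lt_or_eq_dec _ _ (proj2 Hx)) as [Hlt | ->]; [|lra].
  destruct (mean_value_seg x a (fun z => u z t) (fun z => ux z t))
      as [z [Hz1 Hz2]]; [exact Hlt | | |].
  - eapply continuous_on_slice; [|exact Hc]; simpl; intros z Hz; lra.
  - intros z Hz; apply (is_derive_seg_interior a (fun y => u y t)); [lra|]; apply Hux; lra.
  - specialize (Hle z ltac:(lra)); nra.
Qed.

(* The caloric polynomial [K (y^2 / (2 l) + (r - t1) / l - l)], with
   [y = x - (a - l)], has flux [K] at [x = a], is nonpositive at [r = t1] and, while
   [r - t1 <= l^2], at [y = 0], and reaches [K l / 2] at [x = a] when [r - t1 = l^2]. *)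
Lemma boundary_growth (a p q T : R) (u0 : R -> R) (u : R -> R -> R) :
  0 < a -> 0 < q -> is_solution a p q T u0 u ->
  (forall x s t, 0 <= x <= a -> 0 <= s <= t -> t < T -> u x s <= u x t) ->
  forall t t1 l, 0 < t <= t1 -> 0 < l <= a -> t1 + l * l < T ->
    (Rpower (1 - u a t1) (- q) - Rpower (1 - u a t) (- q)) * l / 2
      <= u a (t1 + l * l) - u a t.
Proof.
  intros Ha Hq Hsol Hmono t t1 l Ht Hl HT.
  assert (Htan := solution_above_tangent a p q T u0 u Hsol Hmono).
  destruct Hsol as
    (Hc & Hrange & _ & ux & uxx & ut & Hux & Huxx & Hut & _ & _ & _ & Heq & _ & Hba).
  assert (Hll : 0 < l * l) by nra.
  set (F := Rpower (1 - u a t) (- q)) in *.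
  assert (HF : forall r, t1 <= r < T -> Rpower (1 - u a t1) (- q) <= ux a r).
  (* The flux at [x = a] increases with [u a r], hence with time. *)
  { intros r Hr; rewrite Hba, !Rpower_Ropp by lra.
    assert (H1 := Hrange a r ltac:(lra) ltac:(lra)).
    assert (H2 := Hmono a t1 r ltac:(lra) ltac:(lra) ltac:(lra)).
    apply Rinv_le_contravar; [apply exp_pos | apply Rle_Rpower_l; lra]. }
  set (K := Rpower (1 - u a t1) (- q) - F) in *.
  assert (HK : 0 <= K).
  { unfold K, F; rewrite !Rpower_Ropp.
    assert (H1 := Hrange a t1 ltac:(lra) ltac:(lra)).
    assert (H2 := Hmono a t t1 ltac:(lra) ltac:(lra) ltac:(lra)).
    apply (proj1 (Rminus_le_0 _ _)), Rinv_le_contravar; [apply exp_pos | apply Rle_Rpower_l; lra]. }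
  (* The tangent at time [t] plus the caloric polynomial. *)
  set (Z := fun x r => u a t + F * (x - a)
       + K / l * ((x - (a - l)) * (x - (a - l)) / 2 + (r - t1) - l * l)).
  assert (HKl : 0 <= K / l) by (apply Rmult_le_pos; [lra | apply Rlt_le, Rinv_0_lt_compat; lra]).
  assert (Hge : forall x r, 0 <= x <= a -> t1 <= r <= t1 + l * l ->
             u a t + F * (x - a) <= u x r).
  { intros x r Hx Hr; apply Rle_trans with (u x t); [apply Htan; lra | apply Hmono; lra]. }
  assert (HZ : forall x r, is_derive (fun y => Z y r) x (F + K / l * (x - (a - l)))).
  { intros x r; unfold Z; auto_derive; [auto|]; field; lra. }
  assert (Hfin : 0 <= u a (t1 + l * l) - Z a (t1 + l * l)).
  (* Comparison on [[a - l, a]] with [L = 0]. Initially and at [x = a - l], [u] lies above the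
     tangent and the polynomial is nonpositive; at [x = a] the flux of [Z] is [F + K], at most that
     of [u]. *)
  { apply (robin_comparison (a - l) a t1 (t1 + l * l) 0 (fun x r => u x r - Z x r)
      (fun x r => ux x r - (F + K / l * (x - (a - l)))) (fun x r => uxx x r - K / l)
      (fun x r => ut x r - K / l)); try lra.
    - apply continuous_on_minus_2.
      + revert Hc; apply continuous_on_subset; intros z Hz; lra.
      + apply continuous_on_forall; intros [x r] _; unfold Z.
        apply (continuous_plus (fun z : R * R => u a t + F * (fst z - a))
          (fun z : R * R => K / l * ((fst z - (a - l)) * (fst z - (a - l)) / 2 + (snd z - t1) - l * l))).
        * apply (continuous_comp (fun z : R * R => fst z) (fun y => u a t + F * (y - a))).
          { apply continuous_fst. }
          apply (ex_derive_continuous (fun y => u a t + F * (y - a))); auto_derive; auto.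
        * apply (continuous_ext (fun z : R * R =>
              K / l * ((fst z - (a - l)) * (fst z - (a - l)) / 2) + K / l * (snd z - t1 - l * l))).
          { intros z; apply Rminus_diag_uniq; ring. }
          apply (continuous_plus (fun z : R * R => K / l * ((fst z - (a - l)) * (fst z - (a - l)) / 2))
            (fun z : R * R => K / l * (snd z - t1 - l * l))).
          -- apply (continuous_comp (fun z : R * R => fst z)
               (fun y => K / l * ((y - (a - l)) * (y - (a - l)) / 2))); [apply continuous_fst|].
             apply (ex_derive_continuous (fun y => K / l * ((y - (a - l)) * (y - (a - l)) / 2)));
               auto_derive; auto.
          -- apply (continuous_comp (fun z : R * R => snd z)
               (fun r => K / l * (r - t1 - l * l))); [apply continuous_snd|].
             apply (ex_derive_continuous (fun r => K / l * (r - t1 - l * l))); auto_derive; auto.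
    - intros x Hx; assert (H1 := Hge x t1 ltac:(lra) ltac:(lra)); unfold Z.
      assert (K / l * ((x - (a - l)) * (x - (a - l)) / 2 + (t1 - t1) - l * l) <= 0); [|lra].
      assert (0 <= x - (a - l) <= l) by lra.
      set (y := x - (a - l)) in *. assert (y * y <= l * l) by nra. nra.
    - intros x r Hx Hr; apply (is_derive_minus (fun y => u y r) (fun y => Z y r)).
      + apply (is_derive_seg_interior a (fun y => u y r)); [lra | apply Hux; lra].
      + apply HZ.
    - intros x r Hx Hr; apply (is_derive_minus (fun y => ux y r)
        (fun y => F + K / l * (y - (a - l)))).
      + apply Huxx; lra.
      + auto_derive; [auto|]; field; lra.
    - intros x r Hx Hr; apply (is_derive_minus (fun s => u x s) (fun s => Z x s)).
      + apply Hut; lra.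
      + unfold Z; auto_derive; [auto|]; field; lra.
    - intros x r Hx Hr; rewrite Heq; lra.
    - intros r Hr Hneg; exfalso.
      assert (H1 := Hge (a - l) r ltac:(lra) ltac:(lra)); unfold Z in Hneg.
      assert (K / l * ((a - l - (a - l)) * (a - l - (a - l)) / 2 + (r - t1) - l * l) <= 0); [|lra].
      replace (a - l - (a - l)) with 0 by ring. nra.
    - intros r Hr Hneg; exists (ux a r - (F + K / l * (a - (a - l)))); split.
      + apply (is_derive_seg_at_left a (fun y => u y r - Z y r)); [exact Ha|].
        apply is_derive_seg_minus; [apply Hux; lra | apply is_derive_is_derive_seg, HZ].
      + replace (K / l * (a - (a - l))) with K by (field; lra).
        assert (H1 := HF r ltac:(lra)); unfold K; lra. }
  unfold Z in Hfin.
  replace (u a t + F * (a - a) + K / l * ((a - (a - l)) * (a - (a - l)) / 2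
    + (t1 + l * l - t1) - l * l)) with (u a t + K * l / 2) in Hfin by (field; lra).
  lra.
Qed.

(** * From the growth estimate to the quenching rate *)

(** Take the [(q + 1)]-th root of both sides: the right side is [w^(q+1)], and [sqrt d] becomes
    [d^(1/(2q+2))]. *)
Lemma rate_from_product (k w d q : R) : 0 < k -> 0 < w -> 0 < d -> 0 < q ->
  k * sqrt d <= w * Rpower w q ->
  Rpower k (1 / (q + 1)) * Rpower d (1 / (2 * q + 2)) <= w.
Proof.
  intros Hk Hw Hd Hq H.
  assert (Hs : 0 < sqrt d) by now apply sqrt_lt_R0.
  replace (w * Rpower w q) with (Rpower w (1 + q)) in H
    by (rewrite Rpower_plus, Rpower_1; auto).
  assert (H1 : Rpower (k * sqrt d) (1 / (q + 1)) <= Rpower (Rpower w (1 + q)) (1 / (q + 1))).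
  { apply Rle_Rpower_l.
    - apply Rlt_le, Rdiv_lt_0_compat; lra.
    - split; [nra | exact H]. }
  rewrite Rpower_mult in H1.
  replace ((1 + q) * (1 / (q + 1))) with 1 in H1 by (field; lra).
  rewrite Rpower_1, <- Rpower_mult_distr, <- Rpower_sqrt, Rpower_mult in H1 by auto.
  now replace (/ 2 * (1 / (q + 1))) with (1 / (2 * q + 2)) in H1 by (field; lra).
Qed.

Theorem theorem3p1 (a p q T : R) (u0 : R -> R) (u : R -> R -> R)
  (ha : 0 < a) (hp : 0 < p) (hq : 0 < q) (hT : 0 < T)
  (hu0 : admissible_initial_datum a p q u0)
  (hu : is_solution a p q T u0 u)
  (hquench : quenches_at a T u)
  (hconvex : forall x, 0 < x < a -> 0 <= Derive_n (fun y => u y 0) 2 x) :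
  exists C1 : R, 0 < C1 /\
    exists t1 : R, 0 <= t1 < T /\
      forall t, t1 < t < T ->
        u a t <= 1 - C1 * Rpower (T - t) (1 / (2 * q + 2)).
Proof.
  assert (Hmono := solution_nondecreasing a p q T u0 u ha hp hq hu0 hu hconvex).
  assert (Hgrow := boundary_growth a p q T u0 u ha hq hu Hmono).
  destruct hu as (Hc & Hrange & _).
  set (e := 1 / (2 * q + 2)).
  assert (He : 0 < e) by (unfold e; apply Rdiv_lt_0_compat; lra).
  (* The flux gap between boundary distances [w] and [2 w] is [(1 - 2^(-q)) w^(-q)]; one factor 1/2
     comes from [Hgrow], the other from the upper bound [2 w] for the growth. *)
  set (kap := (1 - Rpower 2 (- q)) / 4).
  assert (Hkap : 0 < kap).
  { unfold kap; assert (Rpower 2 (- q) < Rpower 2 0) by (apply Rpower_lt; lra).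
    rewrite Rpower_O in H by lra; lra. }
  (* [C0] serves when a doubling time exists, its factor [(1/2)^e] accounting for
     [d = (T - t1) / 2]; [Cr] serves when [1 - u a t1] is at least half its value at time
     [T / 2]. *)
  set (C0 := Rpower kap (1 / (q + 1)) * Rpower (/ 2) e).
  set (Cr := (1 - u a (T / 2)) / 2 / Rpower T e).
  assert (HC0 : 0 < C0) by (unfold C0; apply Rmult_lt_0_compat; apply exp_pos).
  assert (Hr := Hrange a (T / 2) ltac:(lra) ltac:(lra)).
  assert (HCr : 0 < Cr) by (unfold Cr; apply Rdiv_lt_0_compat; [lra | apply exp_pos]).
  exists (Rmin C0 Cr); split; [now apply Rmin_case|].
  (* After [T / 2] there is an earlier reference time; after [T - a^2] the length [sqrt d] used
     below is at most [a]. *)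
  exists (Rmax (T / 2) (T - a * a)); split.
  { generalize (Rmax_l (T / 2) (T - a * a)); intros HM; split; [lra|].
    apply Rmax_lub_lt; nra. }
  intros t1 Ht1.
  assert (HM1 := Rmax_l (T / 2) (T - a * a)). assert (HM2 := Rmax_r (T / 2) (T - a * a)).
  assert (Hw1 := Hrange a t1 ltac:(lra) ltac:(lra)).
  assert (HpT : 0 < Rpower (T - t1) e) by apply exp_pos.
  destruct (Rle_lt_dec ((1 - u a (T / 2)) / 2) (1 - u a t1)) as [Hbig | Hsmall].
  - assert (H1 : Rpower (T - t1) e <= Rpower T e) by (apply Rle_Rpower_l; lra).
    assert (H2 : Cr * Rpower T e = (1 - u a (T / 2)) / 2).
    { unfold Cr; field. apply Rgt_not_eq, exp_pos. }
    assert (H3 := Rmin_r C0 Cr). nra.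
  - (* the earlier time at which [1 - u a] was twice its value at [t1] *)
    destruct (IVT_gen (fun r => u a (clamp (T / 2) t1 r)) (T / 2) t1 (1 - 2 * (1 - u a t1)))
      as [t [Ht Hwt]].
    { intros r; apply continuity_pt_filterlim.
      apply (continuous_on_clamp (T / 2) t1 (fun r => u a r)); [lra|].
      apply (continuous_on_comp (fun z : R * R => 0 <= fst z <= a /\ 0 <= snd z < T)
        _ (fun z => u (fst z) (snd z)) (fun r => (a, r))).
      - intros y Hy; simpl; lra.
      - intros y; apply (continuous_pair (fun _ : R => a) (fun y => y));
          [apply continuous_const | apply continuous_id].
      - exact Hc. }
    { rewrite !clamp_id by lra. rewrite Rmin_left, Rmax_right by lra; lra. }
    rewrite Rmin_left, Rmax_right in Ht by lra. rewrite clamp_id in Hwt by lra.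
    (* Half of the remaining time, so that [t1 + d < T]; the growth estimate is applied with
       [l = sqrt d]. *)
    set (d := (T - t1) / 2).
    assert (Hd : 0 < d) by (unfold d; lra).
    assert (Hsq : sqrt d * sqrt d = d) by (apply sqrt_sqrt; lra).
    assert (Hs : 0 < sqrt d) by now apply sqrt_lt_R0.
    assert (Hsa : sqrt d <= a).
    { rewrite <- (sqrt_Rsqr a) by lra. apply sqrt_le_1_alt. unfold Rsqr, d; lra. }
    assert (H := Hgrow t t1 (sqrt d) ltac:(lra) ltac:(lra)).
    rewrite Hsq in H. specialize (H ltac:(unfold d; lra)).
    assert (Hend := Hrange a (t1 + d) ltac:(lra) ltac:(unfold d; lra)).
    set (w := 1 - u a t1) in *.
    assert (Hw : 0 < w) by (unfold w; lra).
    replace (1 - u a t) with (2 * w) in H by lra.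
    rewrite <- Rpower_mult_distr in H by lra.
    assert (Hwq : Rpower w (- q) * Rpower w q = 1).
    { rewrite <- Rpower_plus, Rplus_opp_l; now apply Rpower_O. }
    assert (Hpq : 0 < Rpower w q) by apply exp_pos.
    assert (Hprod : kap * sqrt d <= w * Rpower w q).
    (* [u < 1] at time [t1 + d] and [u a t = 1 - 2 w] bound the growth by [2 w]. *)
    { assert (H1 : kap * Rpower w (- q) * sqrt d <= w) by (unfold kap; nra).
      apply (Rmult_le_compat_r (Rpower w q)) in H1; [|lra].
      replace (kap * Rpower w (- q) * sqrt d * Rpower w q)
        with (kap * sqrt d * (Rpower w (- q) * Rpower w q)) in H1 by ring.
      rewrite Hwq in H1; lra. }
    apply rate_from_product in Hprod; auto. fold e in Hprod.
    assert (Hdd : Rpower d e = Rpower (/ 2) e * Rpower (T - t1) e).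
    { rewrite Rpower_mult_distr by lra. f_equal; unfold d; lra. }
    rewrite Hdd in Hprod.
    assert (H3 := Rmin_l C0 Cr).
    assert (H4 : C0 * Rpower (T - t1) e <= w) by (unfold C0; lra).
    unfold w in H4. nra.
Qed.
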